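(* Let $D$ be an integral domain and let $I$ be a nonzero ideal of $D$. If $I$ is flat, then $I$ is a $t$-ideal of $D$.
   Context: $D$ is an integral domain with quotient field $K$. ''Ideal of $D$'' means fractional ideal: a $D$-submodule $I$ of $K$ with $dI\subseteq D$ for some nonzero $d\in D$. An ideal is flat if it is flat as a $D$-module. For $D$-submodules $A,B$ of $K$, $(A:B)=\{x\in K\mid xB\subseteq A\}$. For a nonzero ideal $J$, $J_v=(D:(D:J))$, and for a nonzero ideal $I$, $I_t=\bigcup J_v$, where the union is over all nonzero finitely generated $D$-submodules $J$ of $K$ with $J\subseteq I$. A nonzero ideal $I$ is a $t$-ideal if $I=I_t$. *)

(* Defs.v *)
From HB Require Import structures.
From mathcomp Require Import all_boot all_order all_algebra.
From mathcomp Require Import boolp classical_sets.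

Set Implicit Arguments.
Unset Strict Implicit.
Unset Printing Implicit Defensive.

Import GRing.Theory.
Local Open Scope classical_set_scope.
Local Open Scope ring_scope.
Local Open Scope quotient_scope.

Section Tensor.
Variables (R : comNzRingType) (M N : lmodType R).

(* Formal sums of pure tensors are lists of pairs, the empty list being 0;
   [tensor_eqv] is the least congruence for concatenation that makes
   concatenation commutative and the pairing R-balanced and biadditive.
   Negatives come for free, as -(m, n) is (-m, n). *)
Inductive tensor_eqv : seq (M * N) -> seq (M * N) -> Prop :=
| TensorRefl s : tensor_eqv s s
| TensorSym s t : tensor_eqv s t -> tensor_eqv t s
| TensorTrans s t u : tensor_eqv s t -> tensor_eqv t u -> tensor_eqv s u
| TensorCat s s' t t' :
    tensor_eqv s s' -> tensor_eqv t t' -> tensor_eqv (s ++ t) (s' ++ t')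
| TensorC s t : tensor_eqv (s ++ t) (t ++ s)
| Tensor0 n : tensor_eqv [:: (0, n)] [::]
| TensorDl m m' n : tensor_eqv [:: (m + m', n)] [:: (m, n); (m', n)]
| TensorDr m n n' : tensor_eqv [:: (m, n + n')] [:: (m, n); (m, n')]
| TensorZ a m n : tensor_eqv [:: (a *: m, n)] [:: (m, a *: n)].

Definition tensor_eqvb : rel (seq (M * N)) := fun s t => `[< tensor_eqv s t >].

Lemma tensor_eqvb_refl : reflexive tensor_eqvb.
Proof. by move=> s; apply/asboolP/TensorRefl. Qed.

Lemma tensor_eqvb_sym : symmetric tensor_eqvb.
Proof. by move=> s t; apply/asboolP/asboolP=> h; apply: TensorSym. Qed.

Lemma tensor_eqvb_trans : transitive tensor_eqvb.
Proof.
by move=> t s u /asboolP h /asboolP h'; apply/asboolP/(TensorTrans h h').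
Qed.

Canonical tensor_eqvb_equiv :=
  EquivRel tensor_eqvb tensor_eqvb_refl tensor_eqvb_sym tensor_eqvb_trans.

Definition tensor := {eq_quot tensor_eqvb}.
HB.instance Definition _ : EqQuotient _ tensor_eqvb tensor :=
  EqQuotient.on tensor.
HB.instance Definition _ := Choice.on tensor.

Implicit Types (s t : seq (M * N)) (x y z : tensor).

Lemma tensor_piP s t : \pi_tensor s = \pi_tensor t <-> tensor_eqv s t.
Proof.
split=> [/eqmodP/asboolP //|h]; exact/eqmodP/asboolP.
Qed.

Lemma tensor_ind (P : tensor -> Prop) :
  (forall s, P (\pi_tensor s)) -> forall x, P x.
Proof. by move=> h x; rewrite -[x]reprK; apply: h. Qed.

Lemma tensor_repr s : tensor_eqv (repr (\pi_tensor s)) s.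
Proof. by apply/tensor_piP; rewrite reprK. Qed.

Definition scale_seq (a : R) s := [seq (a *: p.1, p.2) | p <- s].

Lemma scale_seqP a s t :
  tensor_eqv s t -> tensor_eqv (scale_seq a s) (scale_seq a t).
Proof.
elim=> {s t} /=.
- by move=> s; apply: TensorRefl.
- by move=> s t _; apply: TensorSym.
- by move=> s t u _ h _; apply: TensorTrans.
- by move=> s s' t t' _ h _ h'; rewrite /scale_seq !map_cat; apply: TensorCat.
- by move=> s t; rewrite /scale_seq !map_cat; apply: TensorC.
- by move=> n; rewrite scaler0; apply: Tensor0.
- by move=> m m' n; rewrite scalerDr; apply: TensorDl.
- by move=> m n n'; apply: TensorDr.
- by move=> b m n; rewrite scalerA mulrC -scalerA; apply: TensorZ.
Qed.

Definition tensor_zero : tensor := \pi_tensor [::].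
Definition tensor_add x y : tensor := \pi_tensor (repr x ++ repr y).
Definition tensor_scale (a : R) x : tensor := \pi_tensor (scale_seq a (repr x)).
Definition tensor_opp x : tensor := tensor_scale (-1) x.

Lemma tensor_addE s t :
  tensor_add (\pi_tensor s) (\pi_tensor t) = \pi_tensor (s ++ t).
Proof. by apply/tensor_piP/TensorCat; apply: tensor_repr. Qed.

Lemma tensor_scaleE a s :
  tensor_scale a (\pi_tensor s) = \pi_tensor (scale_seq a s).
Proof. exact/tensor_piP/scale_seqP/tensor_repr. Qed.

Lemma tensor_addA : associative tensor_add.
Proof.
elim/tensor_ind=> s; elim/tensor_ind=> t; elim/tensor_ind=> u.
by rewrite !tensor_addE catA.
Qed.

Lemma tensor_addC : commutative tensor_add.
Proof.
elim/tensor_ind=> s; elim/tensor_ind=> t.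
by rewrite !tensor_addE; apply/tensor_piP/TensorC.
Qed.

Lemma tensor_add0 : left_id tensor_zero tensor_add.
Proof. by elim/tensor_ind=> s; rewrite tensor_addE. Qed.

Lemma tensor_scaleDl x a b :
  tensor_scale (a + b) x = tensor_add (tensor_scale a x) (tensor_scale b x).
Proof.
elim/tensor_ind: x => s; rewrite !tensor_scaleE tensor_addE; apply/tensor_piP.
elim: s => [|[m n] s IH] /=; first exact: TensorRefl.
set u := scale_seq a s in IH *; set v := scale_seq b s in IH *.
have h : tensor_eqv [:: (((a + b) *: m, n) : M * N)]
                    ([:: (a *: m, n)] ++ [:: (b *: m, n)]).
  by rewrite scalerDl; apply: TensorDl.
apply: TensorTrans (TensorCat h IH) _ => /=.
apply: (TensorCat (TensorRefl [:: (a *: m, n)])).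
rewrite -cat1s catA -[in X in tensor_eqv _ X](cat1s _ v) catA.
exact: TensorCat (TensorC _ _) (TensorRefl _).
Qed.

Lemma tensor_scale0 x : tensor_scale 0 x = tensor_zero.
Proof.
elim/tensor_ind: x => s; rewrite tensor_scaleE; apply/tensor_piP.
elim: s => [|[m n] s IH] /=; first exact: TensorRefl.
by rewrite scale0r; apply: (TensorCat (Tensor0 n) IH).
Qed.

Lemma tensor_scale1 : left_id 1 tensor_scale.
Proof.
elim/tensor_ind=> s; rewrite tensor_scaleE; congr (\pi_tensor _).
by rewrite -[RHS]map_id; apply: eq_map => -[m n] /=; rewrite scale1r.
Qed.

Lemma tensor_addN : left_inverse tensor_zero tensor_opp tensor_add.
Proof.
move=> x; rewrite -[X in tensor_add _ X]tensor_scale1 -tensor_scaleDl addNr.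
exact: tensor_scale0.
Qed.

HB.instance Definition _ :=
  GRing.isZmodule.Build tensor tensor_addA tensor_addC tensor_add0 tensor_addN.

Lemma tensor_scaleA a b x :
  tensor_scale a (tensor_scale b x) = tensor_scale (a * b) x.
Proof.
elim/tensor_ind: x => s; rewrite !tensor_scaleE; congr (\pi_tensor _).
by rewrite /scale_seq -map_comp; apply: eq_map => p /=; rewrite scalerA.
Qed.

Lemma tensor_scaleDr : right_distributive tensor_scale +%R.
Proof.
move=> a; elim/tensor_ind=> s; elim/tensor_ind=> t.
rewrite /GRing.add /= tensor_addE !tensor_scaleE tensor_addE.
by rewrite /scale_seq map_cat.
Qed.

HB.instance Definition _ := GRing.Zmodule_isLmodule.Build R tensor
  tensor_scaleA tensor_scale1 tensor_scaleDr tensor_scaleDl.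

Lemma tensor_pi_scale a s :
  a *: (\pi_tensor s : tensor) = \pi_tensor (scale_seq a s).
Proof. exact: tensor_scaleE. Qed.

Lemma tensor_pi_add s t :
  (\pi_tensor s : tensor) + \pi_tensor t = \pi_tensor (s ++ t).
Proof. exact: tensor_addE. Qed.

Definition pure_tensor (m : M) (n : N) : tensor := \pi_tensor [:: (m, n)].

Lemma pure_tensor_bilinear : bilinear_for *:%R *:%R pure_tensor.
Proof.
split=> [n a m m'|m a n n']; rewrite /= /pure_tensor
  tensor_pi_scale tensor_pi_add.
  by apply/tensor_piP/TensorDl.
apply/tensor_piP; apply: TensorTrans (TensorDr _ _ _) _.
exact: TensorCat (TensorSym (TensorZ a m n)) (TensorRefl [:: (m, n')]).
Qed.

HB.instance Definition _ :=
  bilinear_isBilinear.Build R M N tensor *:%R *:%R pure_tensor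
    pure_tensor_bilinear.

Lemma tensor_pi_sum s :
  \pi_tensor s = \sum_(p <- s) pure_tensor p.1 p.2.
Proof.
elim: s => [|[m n] s IH]; first by rewrite big_nil.
by rewrite big_cons -IH tensor_pi_add.
Qed.

Section Lift.
Variables (P : lmodType R) (b : {bilinear M -> N -> P}).

Definition tensor_lift x : P := \sum_(p <- repr x) b p.1 p.2.

Lemma tensor_lift_pi s : tensor_lift (\pi_tensor s) = \sum_(p <- s) b p.1 p.2.
Proof.
rewrite /tensor_lift; move: (repr _) (tensor_repr s) => t.
elim=> {s t} /=.
- by [].
- by move=> s t _ ->.
- by move=> s t u _ -> _ ->.
- by move=> s s' t t' _ h _ h'; rewrite !big_cat /= h h'.
- by move=> s t; rewrite !big_cat /= addrC.
- by move=> n; rewrite big_seq1 big_nil linear0l.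
- by move=> m m' n; rewrite !big_cons big_nil !addr0 linearDl.
- by move=> m n n'; rewrite !big_cons big_nil !addr0 linearDr.
- by move=> a m n; rewrite !big_seq1 linearZl_LR linearZr_LR.
Qed.

Lemma tensor_lift_pure m n : tensor_lift (pure_tensor m n) = b m n.
Proof. by rewrite tensor_lift_pi big_seq1. Qed.

Lemma tensor_lift_linear : linear tensor_lift.
Proof.
move=> a; elim/tensor_ind=> s; elim/tensor_ind=> t.
rewrite tensor_pi_scale tensor_pi_add !tensor_lift_pi big_cat scaler_sumr big_map.
by congr (_ + _); apply: eq_bigr => p _; rewrite linearZl_LR.
Qed.

HB.instance Definition _ :=
  GRing.isLinear.Build R tensor P *:%R tensor_lift tensor_lift_linear.

Lemma tensor_lift_unique (g : {linear tensor -> P}) :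
  (forall m n, g (pure_tensor m n) = b m n) -> g =1 tensor_lift.
Proof.
move=> gb; elim/tensor_ind=> s.
by rewrite tensor_lift_pi tensor_pi_sum linear_sum; apply: eq_bigr.
Qed.

End Lift.
End Tensor.

Section TensorMap.
Variables (R : comNzRingType) (M N N' : lmodType R) (f : {linear N -> N'}).

Definition pure_tensor_map (m : M) (n : N) : tensor M N' := pure_tensor m (f n).

Lemma pure_tensor_map_bilinear : bilinear_for *:%R *:%R pure_tensor_map.
Proof.
split=> [n a m m'|m a n n']; rewrite /pure_tensor_map ?linearPl //.
by rewrite linearP linearPr.
Qed.

HB.instance Definition _ :=
  bilinear_isBilinear.Build R M N (tensor M N') *:%R *:%R pure_tensor_map
    pure_tensor_map_bilinear.

(* The map id_M (x) f. *)
Definition tensor_map : tensor M N -> tensor M N' :=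
  tensor_lift pure_tensor_map.

HB.instance Definition _ := GRing.Linear.on tensor_map.

Lemma tensor_map_pure m n :
  tensor_map (pure_tensor m n) = pure_tensor m (f n).
Proof. exact: tensor_lift_pure. Qed.

End TensorMap.

Definition flat (R : comNzRingType) (M : lmodType R) : Prop :=
  forall (N N' : lmodType R) (f : {linear N -> N'}),
    injective f -> injective (tensor_map (M := M) f).

(* A submodule of V, given by its membership predicate, as a module. *)
Section SubmodType.
Variables (R : pzRingType) (V : lmodType R) (S : submodClosed V).

Record submod_type := SubmodElt { submod_val : V; _ : submod_val \in S }.

HB.instance Definition _ := [isSub for submod_val].
HB.instance Definition _ := [Choice of submod_type by <:].
HB.instance Definition _ := [SubChoice_isSubLmodule of submod_type by <:].

End SubmodType.

Section FractionModule.
Variable D : idomainType.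
Local Notation K := {fraction D}.

Definition scale_frac (d : D) (x : K) : K := tofrac d * x.

Lemma scale_fracA a b x : scale_frac a (scale_frac b x) = scale_frac (a * b) x.
Proof. by rewrite /scale_frac tofracM mulrA. Qed.

Lemma scale_frac1 : left_id 1 scale_frac.
Proof. by move=> x; rewrite /scale_frac tofrac1 mul1r. Qed.

Lemma scale_fracDr : right_distributive scale_frac +%R.
Proof. by move=> a x y; rewrite /scale_frac mulrDr. Qed.

Lemma scale_fracDl x : {morph scale_frac^~ x : a b / a + b}.
Proof. by move=> a b; rewrite /scale_frac tofracD mulrDl. Qed.

HB.instance Definition _ := GRing.Zmodule_isLmodule.Build D K
  scale_fracA scale_frac1 scale_fracDr scale_fracDl.

End FractionModule.

Section Ideals.
Variable D : idomainType.
Local Notation K := {fraction D}.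
Implicit Types (A B J : set K).

(* D as a subset of its quotient field. *)
Definition base_ring : set K := range (@tofrac D).

Definition colon A B : set K := [set x | [set x * b | b in B] `<=` A].

Definition v_closure J : set K := colon base_ring (colon base_ring J).

Definition nonzero J : Prop := exists2 x, J x & x != 0.

Definition fin_gen J : Prop :=
  exists (n : nat) (g : 'I_n -> K),
    J = [set \sum_(i < n) c i *: g i | c in [set: 'I_n -> D]].

Definition t_closure A : set K :=
  \bigcup_(J in [set J | [/\ fin_gen J, nonzero J & J `<=` A]]) v_closure J.

(* Fractional ideals; being a D-submodule of K is part of the type of I. *)
Definition is_ideal (I : submodClosed K) : Prop :=
  exists2 d : D, d != 0 & [set d *: x | x in [set` I]] `<=` base_ring.

Definition t_ideal (I : submodClosed K) : Prop :=
  [/\ is_ideal I, nonzero [set` I] & [set` I] = t_closure [set` I]].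

End Ideals.

(* Main.v *)
Require Import Defs.
From HB Require Import structures.
From mathcomp Require Import all_boot all_order all_algebra.
From mathcomp Require Import boolp classical_sets.

(** Let J be a finitely generated submodule of the flat fractional ideal I.
    The whole point is the identity 1 \in I (D : J): it gives
    J_v = J_v 1 <= I (J_v (D : J)) <= I D = I, and I_t is the union of
    these J_v. The inclusion I <= I_t is formal.

    The identity holds because flatness makes multiplication by I commute
    with finite intersections. If g_1, ..., g_n generate J, then (D : J) is
    the intersection of the g_i^-1 D, so I (D : J) is the intersection of the
    g_i^-1 I, and each of these contains 1 because g_i lies in I.

    Flatness enters through the equational criterion [flat_equational]: a
    linear relation between elements of a flat module is a combination of
    scalar solutions of the same relation. In [flat_mul_colon1], once
    denominators are cleared, the memberships 1 \in g_i^-1 I become a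
    system of linear relations in I, and its scalar solutions are elements
    of (D : J) up to a common factor. The criterion in turn comes from
    tensoring I with the inclusion of the image of a matrix into a free
    module. *)

Import GRing.Theory.

Section EquationalCriterion.
Local Open Scope ring_scope.
Local Open Scope quotient_scope.

(** A map that is bilinear only modulo S still sends equal tensors to values
    congruent modulo S. This is the universal property of the tensor product
    for the target P / S, without forming that quotient. *)
Lemma tensor_eqv_mod (R : comNzRingType) (M N P : lmodType R)
    (S : submodClosed P) (h : M -> N -> P) :
  (forall a m m' n, h (a *: m + m') n = a *: h m n + h m' n) ->
  (forall m n n', h m (n + n') - (h m n + h m n') \in S) ->
  (forall a m n, h m (a *: n) - a *: h m n \in S) ->
  forall s t, tensor_eqv s t ->
  \sum_(p <- s) h p.1 p.2 - \sum_(p <- t) h p.1 p.2 \in S.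
Proof.
move=> hl hDr hZr.
have SN x : x \in S -> - x \in S by rewrite -scaleN1r; apply: rpredZ.
have h0 n : h 0 n = 0.
  have /eqP := hl 1 0 0 n; rewrite !scale1r addr0 -subr_eq0 opprD addNKr.
  by rewrite oppr_eq0 => /eqP.
move=> s t; elim=> {s t}.
- by move=> s; rewrite subrr rpred0.
- by move=> s t _ /SN; rewrite opprB.
- by move=> s t u _ IH _ IH'; rewrite -(subrKA (\sum_(p <- t) h p.1 p.2)) rpredD.
- by move=> s s' t t' _ IH _ IH'; rewrite !big_cat /= opprD addrACA rpredD.
- by move=> s t; rewrite !big_cat /= addrC subrr rpred0.
- by move=> n; rewrite big_seq1 big_nil /= h0 subrr rpred0.
- move=> m m' n; rewrite !big_cons !big_nil !addr0 /=.
  by have := hl 1 m m' n; rewrite !scale1r => ->; rewrite subrr rpred0.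
- by move=> m n n'; rewrite !big_cons !big_nil !addr0 /= hDr.
move=> a m n; rewrite !big_seq1 /= -[a *: m]addr0 hl h0 addr0.
by rewrite -opprB SN.
Qed.

Section ImageKernel.
Variables (R : comNzRingType) (M : lmodType R) (p n : nat) (A : 'M[R]_(p, n)).

Definition row_image : {pred 'rV[R]_n} :=
  [pred v | `[< exists u : 'rV_p, v = u *m A >]].

Lemma row_image_submod : submod_closed row_image.
Proof.
split=> [|a _ _ /asboolP[u ->] /asboolP[u' ->]]; apply/asboolP.
  by exists 0; rewrite mul0mx.
by exists (a *: u + u'); rewrite mulmxDl scalemxAl.
Qed.

HB.instance Definition _ :=
  GRing.isSubmodClosed.Build R 'rV[R]_n row_image row_image_submod.

(** Families (m_j) in M are the elements of M (x) R^p; this is the image in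
    M (x) R^p of M (x) ker A. *)
Definition kernel_combination : {pred {ffun 'I_p -> M}} :=
  [pred f | `[< exists2 s : seq ('rV[R]_p * M),
      {in s, forall x, x.1 *m A = 0} &
      f = [ffun j => \sum_(x <- s) x.1 0 j *: x.2] >]].

Lemma kernel_combination_submod : submod_closed kernel_combination.
Proof.
split=> [|a _ _ /asboolP[s sA ->] /asboolP[t tA ->]]; apply/asboolP.
  by exists [::] => //; apply/ffunP=> j; rewrite !ffunE big_nil.
exists ([seq (a *: x.1, x.2) | x <- s] ++ t).
  move=> x; rewrite mem_cat => /orP[/mapP[y ys ->]|/tA //] /=.
  by rewrite -scalemxAl sA ?scaler0.
apply/ffunP=> j; rewrite !ffunE big_cat big_map /= scaler_sumr; congr (_ + _).
by apply: eq_bigr => x _; rewrite mxE scalerA.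
Qed.

HB.instance Definition _ :=
  GRing.isSubmodClosed.Build R {ffun 'I_p -> M} kernel_combination
    kernel_combination_submod.

Definition row_scale (m : M) (u : 'rV[R]_p) : {ffun 'I_p -> M} :=
  [ffun j => u 0 j *: m].

Lemma row_scale_kernel (m : M) (u : 'rV_p) :
  u *m A = 0 -> row_scale m u \in kernel_combination.
Proof.
move=> uA; apply/asboolP; exists [:: (u, m)].
  by move=> x; rewrite inE => /eqP->.
by apply/ffunP=> j; rewrite !ffunE big_seq1.
Qed.

(** Tensoring the inclusion of the image of A into R^n with the flat module M
    keeps it injective. The element \sum_j m_j (x) (row j of A) becomes
    \sum_i (\sum_j A_ji m_j) (x) e_i = 0 in M (x) R^n, so it vanishes already
    in M (x) im A. Identifying im A with R^p modulo ker A, this says that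
    (m_j) is zero modulo the families coming from ker A. *)
Lemma flat_equational (m : 'I_p -> M) :
  flat M -> (forall i, \sum_j A j i *: m j = 0) ->
  exists2 s : seq ('rV[R]_p * M),
    {in s, forall x, x.1 *m A = 0} &
    forall j, m j = \sum_(x <- s) x.1 0 j *: x.2.
Proof.
move=> Mflat Am0; pose N := submod_type row_image.
have row_in j : row j A \in row_image.
  by apply/asboolP; exists (delta_mx 0 j); rewrite rowE.
pose r j : N := SubmodElt (row_in j).
pose s0 : seq (M * N) := [seq (m j, r j) | j <- enum 'I_p].
have s0_eqv0 : tensor_eqv s0 [::].
  apply/tensor_piP; apply: (Mflat _ _ (val : {linear N -> 'rV[R]_n})) => //.
    exact: val_inj.
  have -> : \pi_(tensor M N) [::] = 0 by [].
  rewrite linear0 tensor_pi_sum linear_sum big_map big_enum /=.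
  pose e i : 'rV[R]_n := delta_mx 0 i.
  transitivity (\sum_j \sum_i pure_tensor (A j i *: m j) (e i)).
    apply: eq_bigr => j _; rewrite tensor_map_pure /= (row_sum_delta (row j A)).
    rewrite linear_sumr; apply: eq_bigr => i _.
    by rewrite linearZr_LR linearZl_LR mxE.
  rewrite exchange_big big1 // => i _.
  by rewrite -linear_sumlz Am0 linear0l.
have coord (v : N) : {u : 'rV_p | val v = u *m A}.
  by have /asboolP/cid := valP v.
(* A section of A on its image: it is linear only modulo ker A, which is all
   that tensor_eqv_mod asks for. *)
pose c v := sval (coord v).
have cE v : c v *m A = val v by rewrite -(svalP (coord v)).
have rsB x u v : row_scale x (u - v) = row_scale x u - row_scale x v.
  by apply/ffunP=> j; rewrite !ffunE !mxE scalerBl.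
have rsD x u v : row_scale x (u + v) = row_scale x u + row_scale x v.
  by apply/ffunP=> j; rewrite !ffunE !mxE scalerDl.
have rsZ x a u : row_scale x (a *: u) = a *: row_scale x u.
  by apply/ffunP=> j; rewrite !ffunE !mxE scalerA.
pose h x v := row_scale x (c v).
have ker x u v : (u - v) *m A = 0 ->
    row_scale x u - row_scale x v \in kernel_combination.
  by move=> uvA; rewrite -rsB row_scale_kernel.
have hK : \sum_(x <- s0) h x.1 x.2 - \sum_(x <- [::]) h x.1 x.2
    \in kernel_combination.
  apply: (tensor_eqv_mod R M N _ kernel_combination h) s0_eqv0
    => [a x x' v|x v v'|a x v].
  - by apply/ffunP=> j; rewrite !ffunE scalerDr !scalerA mulrC.
  - by rewrite -rsD ker // mulmxBl mulmxDl !cE subrr.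
  by rewrite -rsZ ker // mulmxBl -scalemxAl !cE subrr.
(* The section sends row j of A to the j-th unit vector modulo ker A, so
   (m_j) is congruent to the value of h on the vanishing tensor. *)
have mK : [ffun j => m j] \in kernel_combination.
  have -> : [ffun j => m j] =
      \sum_j (row_scale (m j) (delta_mx 0 j) - h (m j) (r j))
      + \sum_j h (m j) (r j).
    rewrite sumrB subrK; apply/ffunP=> j; rewrite sum_ffunE ffunE (bigD1 j) //=.
    rewrite big1 => [|k kj]; rewrite ffunE mxE eqxx /= ?eqxx ?scale1r ?addr0 //.
    by rewrite eq_sym (negPf kj) scale0r.
  apply: rpredD; last by move: hK; rewrite big_nil subr0 big_map big_enum.
  by apply: rpred_sum => j _; rewrite ker // mulmxBl cE -rowE subrr.
have /asboolP[s sA /ffunP mE] := mK; exists s => // j.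
by have := mE j; rewrite !ffunE.
Qed.
End ImageKernel.
End EquationalCriterion.

Section FlatIdeals.
Local Open Scope ring_scope.
Local Open Scope classical_set_scope.
Variable D : idomainType.
Local Notation K := {fraction D}.
Variable I : submodClosed K.

(** This is 1 \in I (D : J) for J generated by the g_i. Let d be a nonzero
    element of D with d I <= D, and let e be a nonzero element of I that
    lies in D. Put a_i = d g_i, which is in D. The elements e, g_1, ..., g_n
    of I satisfy a_i e = (e d) g_i. A scalar solution
    (u_0, u_1, ..., u_n) of this system has (u_0 / e) g_i = u_i in D, so
    u_0 / e \in (D : J). Writing e as a combination of such u_0 with
    coefficients in I and dividing by e gives 1. *)
Lemma flat_mul_colon1 (n : nat) (g : 'I_n -> K) :
  is_ideal I -> nonzero [set` I] -> flat (submod_type I) ->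
  (forall i, g i \in I) ->
  exists2 s : seq (K * K),
    {in s, forall x, (forall i, base_ring (x.1 * g i)) /\ x.2 \in I} &
    \sum_(x <- s) x.1 * x.2 = 1.
Proof.
move=> [d d0 dI] [w wI w0] Iflat gI.
have intD x : x \in I -> {a : D | d *: x = tofrac a}.
  by move=> xI; apply: cid; have [|a _ <-] := dI (d *: x); [exists x | exists a].
pose a i := sval (intD _ (gI i)).
have aE i : d *: g i = tofrac (a i) := svalP (intD _ (gI i)).
have [e eE] := intD w wI.
have eI : tofrac e \in I by rewrite -eE rpredZ.
have e0 : tofrac e != 0 by rewrite -eE mulf_neq0 ?tofrac_eq0.
have d0' : tofrac d != 0 by rewrite tofrac_eq0.
(* Index 0 stands for e and index 1 + i for g_i. *)
pose A : 'M[D]_(1 + n, n) := col_mx (\row_i a i) (- (e * d)%:M).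
pose m (j : 'I_(1 + n)) : submod_type I :=
  match split j with inl _ => SubmodElt eI | inr i => SubmodElt (gI i) end.
have [i|s sA mE] := flat_equational D _ _ _ A m Iflat.
  apply: val_inj; rewrite linear_sum /= big_split_ord big_ord1 /=.
  rewrite col_mxEu mxE /m (unsplitK (inl _)) (bigD1 i) //= big1 => [|k ki].
    rewrite col_mxEd !mxE eqxx mulr1n (unsplitK (inr _)) addr0 /=.
    rewrite [LHS](_ : _ = tofrac (a i) * tofrac e - tofrac (e * d) * g i).
      by rewrite -aE tofracM -mulrA [X in _ - X]mulrC; apply/eqP; rewrite subr_eq0.
    by rewrite {1}/GRing.scale /= {1}/GRing.scale /= /scale_frac tofracN mulNr.
  by rewrite col_mxEd !mxE (negPf ki) mulr0n oppr0 scale0r.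
pose j0 : 'I_(1 + n) := lshift n ord0.
exists [seq (tofrac (x.1 0 j0) / tofrac e, val x.2) |
         x : 'rV[D]_(1 + n) * submod_type I <- s].
  move=> _ /mapP[[u y] us ->] /=; split=> [i|]; last exact: valP.
  exists (u 0 (rshift 1 i)) => //.
  have /rowP/(_ i) := sA _ us.
  rewrite !mxE big_split_ord big_ord1 /= col_mxEu mxE (bigD1 i) //=.
  rewrite big1 => [|k ki].
    rewrite col_mxEd !mxE eqxx mulr1n addr0 mulrN => /eqP.
    rewrite subr_eq0 => /eqP.
    move=> /(congr1 (@tofrac D)); rewrite !tofracM -aE => uA.
    apply: (mulIf (mulf_neq0 e0 d0')); rewrite -uA.
    by rewrite mulrACA divfK // [g i * _]mulrC.
  by rewrite col_mxEd !mxE (negPf ki) mulr0n oppr0 mulr0.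
rewrite big_map; apply: (mulIf e0); rewrite mul1r mulr_suml.
rewrite [RHS](_ : _ = val (m j0)); last by rewrite /m (unsplitK (inl _)).
rewrite mE linear_sum /=.
by apply: eq_bigr => x _; rewrite mulrAC divfK.
Qed.

Lemma fin_gen_member n (g : 'I_n -> K) i :
  [set \sum_(k < n) c k *: g k | c in [set: 'I_n -> D]] (g i).
Proof.
exists (fun k => (k == i)%:R) => //; rewrite (bigD1 i) //= eqxx scale1r.
by rewrite big1 ?addr0 // => k /negPf->; rewrite scale0r.
Qed.

Lemma subset_v_closure (J : set K) : J `<=` v_closure J.
Proof.
move=> x Jx _ [y yJ <-]; rewrite mulrC.
by apply: yJ; exists x.
Qed.

(** An element x of I lies in a nonzero finitely generated submodule of I even
    when x = 0: add a nonzero element of I as a second generator. *)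
Lemma subset_t_closure : nonzero [set` I] -> [set` I] `<=` t_closure [set` I].
Proof.
move=> [w Iw w0] x Ix.
pose g (i : 'I_2) : K := if i == ord0 then x else w.
exists [set \sum_(i < 2) c i *: g i | c in [set: 'I_2 -> D]].
  split; first by exists 2, g.
    by exists w => //; apply: (fin_gen_member 2 g ord_max).
  move=> _ [c _ <-]; apply: rpred_sum => i _; apply: rpredZ.
  by rewrite /g; case: ifP.
exact/subset_v_closure/(fin_gen_member 2 g ord0).
Qed.

(** Multiply 1 \in I (D : J) by x \in J_v: the products of x with elements of
    (D : J) lie in D. *)
Lemma flat_v_closure_subset (J : set K) :
  is_ideal I -> nonzero [set` I] -> flat (submod_type I) ->
  fin_gen J -> J `<=` [set` I] -> v_closure J `<=` [set` I].
Proof.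
move=> idI nzI Iflat [n [g ->]] JI x xJv.
have gI i : g i \in I by apply: JI; apply: fin_gen_member.
have [s sP s1] := flat_mul_colon1 n g idI nzI Iflat gI.
rewrite /= -[x]mulr1 -s1 mulr_sumr big_seq; apply: rpred_sum => p ps.
have [pg pI] := sP p ps.
have [|a _ aE] := xJv (x * p.1).
  exists p.1 => // _ [_ [c _ <-] <-]; rewrite mulr_sumr.
  have cg i : {b : D | p.1 * (c i *: g i) = tofrac b}.
    apply: cid; have [b _ bE] := pg i; exists (c i * b).
    by rewrite tofracM bE mulrCA.
  exists (\sum_i sval (cg i)) => //; rewrite raddf_sum; apply: eq_bigr => i _.
  exact: esym (svalP (cg i)).
by rewrite mulrA -aE; apply: (rpredZ a).
Qed.

End FlatIdeals.

Theorem theorem1p4 (D : idomainType) (I : submodClosed {fraction D}) :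
  is_ideal I -> nonzero [set` I]%classic -> flat (submod_type I) -> t_ideal I.
Proof.
move=> idI nzI Iflat; split=> //; apply/seteqP; split.
  exact: subset_t_closure.
by move=> x [J [Jfg _ JI]]; apply: flat_v_closure_subset.
Qed.
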